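(* Let $(a_j)_{j\ge 1}$ be real numbers and let $m$ be a real number, with the $a_j$ and $m$ not all zero, and consider the linear operator $$\mathfrak{D} = D_{11} - \sum_{j} a_j t_j D_{2j} - m D_2 .$$ If there is a weight vector $\boldsymbol{\omega}\neq 0$ such that the weighted isobaric polynomials satisfy $\mathfrak{D}(P_{n,\boldsymbol{\omega}})=0$ for all $n\ge 1$, then $a_j=1$ for all $j\ge 1$, and $m=1$ or $m=2$.
   Context: Let $t_1,t_2,\ldots$ be indeterminates. Write $D_{ij}=\partial^2/\partial t_i\partial t_j$ and $D_j=\partial/\partial t_j$. The sum over $j$ in the operator is over all indeterminates; only finitely many terms act non-trivially on a given polynomial. An exponent vector is a finitely supported vector $\alpha=(\alpha_1,\alpha_2,\ldots)$ of non-negative integers, and $t^\alpha=\prod_j t_j^{\alpha_j}$. A weight vector is a sequence $\boldsymbol{\omega}=(\omega_1,\omega_2,\ldots)$ of integers. For $n\ge 1$, the weighted isobaric polynomial (WIP) of degree $n$ with weight $\boldsymbol{\omega}$ is $$P_{n,\boldsymbol{\omega}}=\sum_{\alpha} A_\alpha t^\alpha,\qquad A_\alpha=\binom{\sum_j\alpha_j}{\alpha_1\ \alpha_2\ \cdots}\frac{\sum_j\alpha_j\omega_j}{\sum_j\alpha_j},$$ where the sum is over all exponent vectors $\alpha$ with $\sum_j j\alpha_j=n$ (that is, over the partitions $(1^{\alpha_1},2^{\alpha_2},\ldots)$ of $n$), and the binomial symbol is the multinomial coefficient $(\sum_j\alpha_j)!/\prod_j\alpha_j!$. A WIP-sequence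 solution of an operator is a whole sequence $\{P_{n,\boldsymbol{\omega}}\}_{n\ge1}$ all of whose terms are annihilated by the operator. *)

(* Defs.v *)
From mathcomp Require Import all_boot all_order all_algebra finmap.
From mathcomp Require Import boolp classical_sets functions cardinality fsbigop.
From mathcomp Require Import reals monalg.

Set Implicit Arguments.
Unset Strict Implicit.
Unset Printing Implicit Defensive.

Import GRing.Theory Num.Theory.
Local Open Scope classical_set_scope.
Local Open Scope ring_scope.

(* The indices 1, 2, 3, ... of the indeterminates. *)
Definition pindex := {j : nat | (0 < j)%N}.

Definition i1 : pindex := exist _ 1%N isT.
Definition i2 : pindex := exist _ 2%N isT.

(* The polynomial ring in t_1, t_2, ...: {cmonom pindex} is the type of
   finitely supported exponent vectors, and << alpha >> is t^alpha. *)
Notation ipoly R := {malg R[{cmonom pindex}]}.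

Definition tvar (R : realType) (j : pindex) : ipoly R := << ucm j >>.

(* divcm alpha (ucm j) is alpha - e_j, truncated at 0; the truncation only
   occurs when alpha_j = 0, where the coefficient vanishes. *)
Definition pderiv (R : realType) (j : pindex) (p : ipoly R) : ipoly R :=
  \sum_(alpha <- msupp p)
    ((alpha j)%:R * p@_alpha) *: << divcm alpha (ucm j) >>.

Definition isobaric_degree (alpha : {cmonom pindex}) : nat :=
  (\sum_(j <- finsupp alpha) val j * alpha j)%N.

Definition wip_coef (R : realType) (omega : pindex -> int)
    (alpha : {cmonom pindex}) : R :=
  (mdeg alpha)`!%:R / (\prod_(j <- finsupp alpha) (alpha j)`!)%N%:R
  * ((\sum_(j <- finsupp alpha) (alpha j)%:R * (omega j)%:~R)
     / (mdeg alpha)%:R).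

(* [\sum_(x \in A)] is the sum over the finite support of the summand, and 0 by
   convention when that support is infinite. The lemmas [finite_isobaric] and
   [finite_pderiv] below show that the convention is never used in the two
   definitions that follow. *)
Definition wip (R : realType) (n : nat) (omega : pindex -> int) : ipoly R :=
  \sum_(alpha \in [set alpha | isobaric_degree alpha = n])
    wip_coef R omega alpha *: << alpha >>.

Definition opD (R : realType) (a : pindex -> R) (m : R) (p : ipoly R) :
    ipoly R :=
  pderiv i1 (pderiv i1 p)
  - \sum_(j \in [set: pindex]) a j *: (tvar R j * pderiv i2 (pderiv j p))
  - m *: pderiv i2 p.

Lemma finite_isobaric (n : nat) :
  finite_set [set alpha | isobaric_degree alpha = n].
Proof.
set A := [set _ | _].
have le_ja (alpha : {cmonom pindex}) (j : pindex) : A alpha ->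
    (val j * alpha j <= n)%N.
  move=> <-; case: (boolP (j \in finsupp alpha)) => [ja|].
    by rewrite /isobaric_degree (big_fsetD1 j) //= leq_addr.
  by rewrite -cmE_eq0 => /eqP ->; rewrite muln0.
pose f (alpha : {cmonom pindex}) : {ffun 'I_n -> 'I_n.+1} :=
  [ffun i : 'I_n => inord (alpha (exist _ i.+1 isT : pindex))].
have le_a (alpha : {cmonom pindex}) (j : pindex) : A alpha ->
    (alpha j <= n)%N.
  move=> /(le_ja _ j); apply: leq_trans.
  by case: j => j jgt0 /=; rewrite leq_pmull.
have injf : {in A &, injective f}.
  move=> x y; rewrite !inE => xA yA fxy; apply/eqP/cmP => j.
  have [jn|jn] := leqP (val j) n; last first.
    have z (u : {cmonom pindex}) : A u -> u j = 0%N.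
      move=> /(le_ja _ j) lejn; apply/eqP; move: lejn.
      by case: (u j) => // k; rewrite mulnS leqNgt (leq_trans jn) // leq_addr.
    by rewrite !z.
  have jpred : (val j).-1.+1 = val j by case: j {jn} => -[].
  have jlt : ((val j).-1 < n)%N by rewrite jpred.
  have := congr1 (fun g : {ffun _ -> _} => val (g (Ordinal jlt))) fxy.
  rewrite !ffunE /=.
  have -> : (exist _ (val j).-1.+1 isT : pindex) = j.
    by apply: val_inj.
  by rewrite !inordK // ltnS le_a.
have := card_esym (inj_card_eq injf) => /eq_finite_set ->.
exact: finite_finset.
Qed.

Lemma mcoeff_pderiv (R : realType) (j : pindex) (p : ipoly R)
    (alpha : {cmonom pindex}) :
  (pderiv j p)@_alpha = (alpha j).+1%:R * p@_(mmul alpha (ucm j)).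
Proof.
have div_mul (u v : {cmonom pindex}) : (0 < u j)%N ->
    (divcm u (ucm j) == v) = (u == mmul v (ucm j)).
  move=> uj; apply/idP/idP => /cmP uv; apply/cmP => i; move: (uv i);
    rewrite divcmE cmM ucmE.
    by move=> <-; case: eqP => [<-|]; rewrite ?subn0 ?addn0 ?subnK.
  by move=> ->; rewrite addnK.
rewrite raddf_sum /=; under eq_bigr do rewrite mcoeffZ mcoeffU1.
set b := mmul _ _; have bj : b j = (alpha j).+1 by rewrite cmM cmUU addn1.
have E (u : {cmonom pindex}) : (u j)%:R * p@_u * (divcm u (ucm j) == alpha)%:R
    = (if u == b then (alpha j).+1%:R * p@_b else 0) :> R.
  case: (posnP (u j)) => uj; last first.
    by rewrite div_mul //; case: eqP => [->|]; rewrite ?mulr0 // mulr1 bj.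
  rewrite uj !mul0r; case: eqP => // ub.
  by move: bj; rewrite -ub uj.
rewrite (eq_bigr _ (fun u _ => E u)) -big_mkcond /= big_const_seq.
rewrite count_uniq_mem ?fset_uniq //.
case: (boolP (b \in enum_fset _)) => bp /=; first by rewrite addr0.
by rewrite mcoeff_outdom ?mulr0.
Qed.

Lemma finite_pderiv (R : realType) (p : ipoly R) :
  finite_set [set j | pderiv j p != 0].
Proof.
pose s := flatten [seq enum_fset (finsupp u) | u : {cmonom pindex} <- msupp p].
apply: (@sub_finite_set _ _ [set` s]); last exact: finite_seq.
move=> j /=; apply: contraNT => js; apply/eqP/malgP => alpha.
rewrite mcoeff_pderiv mcoeff0 mcoeff_outdom ?mulr0 //.
apply: contra js => bp; apply/flattenP.
exists (enum_fset (finsupp (mmul alpha (ucm j)))); first exact: map_f.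
have : mmul alpha (ucm j) j != 0%N by rewrite cmM cmUU addn1.
by rewrite cmE_neq0.
Qed.

Lemma mcoeff_wip (R : realType) (n : nat) (omega : pindex -> int)
    (alpha : {cmonom pindex}) :
  (wip R n omega)@_alpha =
  if isobaric_degree alpha == n then wip_coef R omega alpha else 0.
Proof.
rewrite /wip fsbig_finite /=; last exact: finite_isobaric.
rewrite raddf_sum /=; under eq_bigr do rewrite mcoeffZ mcoeffU1.
case: eqP => an.
  rewrite (big_fsetD1 alpha) /=; last first.
    by rewrite in_fset_set ?inE //; exact: finite_isobaric.
  rewrite eqxx mulr1 big_seq big1 ?addr0 // => u.
  by rewrite !inE => /andP[/negPf -> _]; rewrite mulr0.
rewrite big_seq big1 // => u.
rewrite in_fset_set ?inE; last exact: finite_isobaric.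
by move=> /= un; case: eqP => [ua|]; rewrite ?mulr0 // -ua in an *.
Qed.

(* Main.v *)
(* Comparing the coefficients of t^beta in D(P_n), with n = |beta|_iso + 2,
   k = sum_j beta_j and s = sum_j beta_j omega_j, and cancelling k!/beta! gives
     (k + 1) (s + 2 omega_1) = (sum_j a_j beta_j + m) (s + omega_2)
   for every exponent vector beta. The cases beta = 0, e_i and e_i + e_j already
   force a = 1 and m in {1, 2}. *)
Require Import Defs.
From mathcomp Require Import all_boot all_order all_algebra reals monalg.
From mathcomp Require Import finmap boolp classical_sets cardinality fsbigop.
From mathcomp Require Import ring lra.
Local Open Scope ring_scope.
Import Order.TTheory GRing.Theory Num.Theory.

(** * Exponent vectors: the effect of adding a unit vector e_j *)

Lemma big_finsupp_widen (S : Type) (idx : S) (op : Monoid.com_law idx)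
    (alpha : {cmonom pindex}) (A : {fset pindex}) (F : pindex -> nat -> S) :
  (forall j, F j 0%N = idx) -> (finsupp alpha `<=` A)%fset ->
  \big[op/idx]_(j <- finsupp alpha) F j (alpha j) =
  \big[op/idx]_(j <- A) F j (alpha j).
Proof.
move=> F0 sA; apply: big_fset_incl => // j _.
by rewrite -cmE_eq0 => /eqP ->.
Qed.

Lemma finsupp_mulU (alpha : {cmonom pindex}) (j : pindex) :
  finsupp (mmul alpha (ucm j)) = (finsupp alpha `|` [fset j])%fset.
Proof. by rewrite mdomD mdomU. Qed.

Lemma cm_mulU_out (alpha : {cmonom pindex}) (i j : pindex) :
  i != j -> mmul alpha (ucm j) i = alpha i.
Proof. by rewrite cmM ucmE eq_sym => /negPf ->; rewrite addn0. Qed.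

Lemma cm_mulU_in (alpha : {cmonom pindex}) (j : pindex) :
  mmul alpha (ucm j) j = (alpha j).+1.
Proof. by rewrite cmM ucmE eqxx addn1. Qed.

(** The vectors [alpha] and alpha + e_j agree away from [j], so the other indices contribute the
    same [r] to both. Keeping [op] abstract covers sums and products at once. *)
Lemma big_finsupp_mulU (S : Type) (idx : S) (op : Monoid.com_law idx)
    (alpha : {cmonom pindex}) (j : pindex) (F : pindex -> nat -> S) :
  (forall i, F i 0%N = idx) ->
  exists r : S,
    \big[op/idx]_(i <- finsupp alpha) F i (alpha i) = op (F j (alpha j)) r /\
    \big[op/idx]_(i <- finsupp (mmul alpha (ucm j))) F i (mmul alpha (ucm j) i)
    = op (F j (alpha j).+1) r.
Proof.
move=> F0; set A := (finsupp alpha `|` [fset j])%fset.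
have jA : j \in A by rewrite !inE eqxx orbT.
exists (\big[op/idx]_(i <- (A `\ j)%fset) F i (alpha i)); split.
  by rewrite (big_finsupp_widen _ _ _ _ A) ?fsubsetUl // (big_fsetD1 j).
rewrite finsupp_mulU (big_fsetD1 j) // cm_mulU_in; congr (op _ _).
rewrite big_seq_cond [RHS]big_seq_cond; apply: eq_bigr => i.
by rewrite !inE andbT => /andP[ij _]; rewrite cm_mulU_out.
Qed.

Definition cmfact (alpha : {cmonom pindex}) : nat :=
  (\prod_(j <- finsupp alpha) (alpha j)`!)%N.

Definition cmdot (R : realType) (c : pindex -> R) (alpha : {cmonom pindex})
    : R :=
  \sum_(j <- finsupp alpha) (alpha j)%:R * c j.

Section Exponents.
Implicit Types (alpha beta : {cmonom pindex}) (i j : pindex).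

Lemma cmfact_mulU alpha j :
  cmfact (mmul alpha (ucm j)) = ((alpha j).+1 * cmfact alpha)%N.
Proof.
have [|r [E1 E2]] :=
  big_finsupp_mulU nat 1%N muln alpha j (fun _ k => k`!); first by [].
by rewrite /cmfact E1 E2 /= factS mulnA.
Qed.

Lemma cmfact_gt0 alpha : (0 < cmfact alpha)%N.
Proof. by apply: prodn_gt0 => j; exact: fact_gt0. Qed.

Lemma cmdot_mulU (R : realType) (c : pindex -> R) alpha j :
  cmdot R c (mmul alpha (ucm j)) = cmdot R c alpha + c j.
Proof.
have [|r [E1 E2]] :=
  big_finsupp_mulU R 0 +%R alpha j (fun i k => k%:R * c i).
  by move=> i; rewrite mul0r.
by rewrite /cmdot E1 E2 /= -natr1; ring.
Qed.

Lemma cmdot1 (R : realType) (c : pindex -> R) : cmdot R c mone = 0.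
Proof. by rewrite /cmdot mdom1 big_seq_fset0. Qed.

Lemma mdeg_mulU alpha j : mdeg (mmul alpha (ucm j)) = (mdeg alpha).+1.
Proof. by rewrite mdegM mdegU addn1. Qed.

Lemma isobaric_degree_mulU alpha j :
  isobaric_degree (mmul alpha (ucm j)) = (isobaric_degree alpha + val j)%N.
Proof.
have [|r [E1 E2]] :=
  big_finsupp_mulU nat 0%N addn alpha j (fun i k => val i * k)%N.
  by move=> i; rewrite muln0.
by rewrite /isobaric_degree E1 E2 /= mulnS -addnA addnC.
Qed.

(* Raising the exponent cancels the denominator |alpha| + 1 of the weight. *)
Lemma wip_coef_mulU (R : realType) (omega : pindex -> int) alpha j :
  (alpha j).+1%:R * wip_coef R omega (mmul alpha (ucm j)) =
  (mdeg alpha)`!%:R / (cmfact alpha)%:R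
  * (cmdot R (fun i => (omega i)%:~R) alpha + (omega j)%:~R).
Proof.
rewrite /wip_coef -/(cmfact _) -/(cmdot R (fun i => (omega i)%:~R) _).
rewrite cmdot_mulU cmfact_mulU mdeg_mulU factS !natrM.
have := cmfact_gt0 alpha; rewrite -(ltr0n R) => /lt0r_neq0 w0.
have k0 : (mdeg alpha).+1%:R != 0 :> R by rewrite pnatr_eq0.
have j0 : (alpha j).+1%:R != 0 :> R by rewrite pnatr_eq0.
move: w0 k0 j0; set w := (cmfact _)%:R; set k := (mdeg _).+1%:R.
set c := (alpha j).+1%:R; clearbody w k c => w0 k0 j0; field.
by rewrite w0 k0 j0.
Qed.

(** * Coefficients of the operator *)

Lemma mcoeff_tvarM (R : realType) j (p : ipoly R) beta :
  (tvar R j * p)@_beta =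
  if beta j == 0%N then 0 else p@_(divcm beta (ucm j)).
Proof.
have mulUP (u : {cmonom pindex}) : (0 < beta j)%N ->
    (mmul (ucm j) u == beta) = (u == divcm beta (ucm j)).
  move=> bj; apply/eqP/eqP => [<-|->]; apply/eqP/cmP => i;
    rewrite ?(divcmE, cmM, ucmE).
    by rewrite addKn.
  by case: eqP => [<-|_] /=; rewrite ?subn0 // subnKC.
rewrite (mcoeffMlw _ msuppU_le (fsubset_refl _)) big_seq_fset1.
rewrite mcoeffUU; case: posnP => bj.
  rewrite big1 // => u _; rewrite mul1r; case: eqP => // ub.
  by move: bj; rewrite -ub cmM ucmE eqxx.
under eq_bigr => u _ do rewrite mul1r mulUP //.
set b := divcm _ _; have [bp|bp] := boolP (b \in msupp p).
  rewrite (big_fsetD1 b) //= eqxx mulr1n big_seq big1 ?addr0 // => u.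
  by rewrite !inE => /andP[/negPf -> _].
rewrite (mcoeff_outdom bp) big_seq big1 // => u up.
by case: eqP => // ub; rewrite -ub up in bp.
Qed.

(** Since D_i and D_j commute, this is the Euler operator t_j D_j, which scales t^beta by beta_j,
    applied to D_i p. *)
Lemma mcoeff_tvar_pderiv2 (R : realType) i j (p : ipoly R) beta :
  (tvar R j * pderiv i (pderiv j p))@_beta =
  (beta j)%:R * ((beta i).+1%:R * p@_(mmul beta (ucm i))).
Proof.
rewrite mcoeff_tvarM; case: eqP => [->|/eqP bj]; first by rewrite mul0r.
set g := divcm _ _.
have bE : beta = mmul g (ucm j).
  apply/eqP/cmP => l; rewrite cmM divcmE ucmE.
  by case: eqP => [<-|_]; rewrite ?subn0 ?addn0 // subnK // lt0n.
rewrite !mcoeff_pderiv bE cm_mulU_in.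
have -> : mmul (mmul g (ucm i)) (ucm j) = mmul (mmul g (ucm j)) (ucm i).
  by rewrite -!mulmA [mmul (ucm i) _]mulmC.
have [->|ij] := eqVneq i j; first by rewrite !cm_mulU_in; ring.
by rewrite (cm_mulU_out _ i) // (cm_mulU_out _ j) 1?eq_sym //; ring.
Qed.

Lemma mcoeff_opD (R : realType) (a : pindex -> R) (m : R) (p : ipoly R) beta :
  (opD a m p)@_beta =
  (beta i1).+1%:R * (mmul beta (ucm i1) i1).+1%:R
    * p@_(mmul (mmul beta (ucm i1)) (ucm i1))
  - (cmdot R a beta + m) * ((beta i2).+1%:R * p@_(mmul beta (ucm i2))).
Proof.
rewrite /opD; set T := (X in _ - X - _).
rewrite mcoeffB mcoeffB mcoeffZ.
rewrite [X in X - _ - _]mcoeff_pderiv [X in _ * X - _ - _]mcoeff_pderiv.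
rewrite [X in _ - _ - _ * X]mcoeff_pderiv.
suff -> : T@_beta =
    cmdot R a beta * ((beta i2).+1%:R * p@_(mmul beta (ucm i2))) by ring.
(* Outside [A] both D_j p and beta_j vanish, so the sum in [opD] and the one in [cmdot] can be
   compared over [A]. *)
pose A := (fset_set [set j | pderiv j p != 0] `|` finsupp beta)%fset.
rewrite /T (fsbigTE A) => [|j]; last first.
  rewrite !inE negb_or in_fset_set ?inE /=; last exact: finite_pderiv.
  move=> /andP[/negP jp _]; have -> : pderiv j p = 0.
    by apply/eqP/negPn/negP => jp0; apply: jp; rewrite inE.
  have -> : pderiv i2 (0 : ipoly R) = 0.
    by apply/malgP => b; rewrite mcoeff_pderiv !mcoeff0 mulr0.
  by rewrite mulr0 scaler0.
rewrite raddf_sum /=.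
rewrite /cmdot (big_finsupp_widen _ _ _ _ A (fun j k => k%:R * a j)).
- rewrite mulr_suml; apply: eq_bigr => j _.
  by rewrite mcoeffZ mcoeff_tvar_pderiv2; ring.
- by move=> j; rewrite mul0r.
- exact: fsubsetUr.
Qed.

Lemma opD_wip_eq0 (R : realType) (a : pindex -> R) (m : R)
    (omega : pindex -> int) beta :
  opD a m (wip R (isobaric_degree beta + 2) omega) = 0 ->
  let s := cmdot R (fun i => (omega i)%:~R) beta in
  (mdeg beta).+1%:R * (s + 2 * (omega i1)%:~R) =
  (cmdot R a beta + m) * (s + (omega i2)%:~R).
Proof.
move=> /(congr1 (fun q : ipoly R => q@_beta)); rewrite mcoeff0 mcoeff_opD.
(* Both beta + 2 e_1 and beta + e_2 have isobaric degree |beta|_iso + 2, so neither coefficient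
   falls in the zero branch. *)
rewrite !mcoeff_wip !isobaric_degree_mulU /= -addnA !eqxx.
rewrite -mulrA !wip_coef_mulU cmdot_mulU cmfact_mulU mdeg_mulU factS !natrM.
have := cmfact_gt0 beta; rewrite -(ltr0n R) => /lt0r_neq0 w0.
have := fact_gt0 (mdeg beta); rewrite -(ltr0n R) => /lt0r_neq0 f0.
have j0 : (beta i1).+1%:R != 0 :> R by rewrite pnatr_eq0.
move: w0 f0 j0; set w := (cmfact _)%:R; set f := _`!%:R.
set c := (beta i1).+1%:R; set k := (mdeg _).+1%:R.
set s := cmdot _ _ _; set x := (omega _)%:~R; set y := (omega _)%:~R.
clearbody w f c k s x y => w0 f0 c0 H.
(* The common factor k!/beta!, here [f / w], is nonzero, so the relation may be checked after
   multiplying by it. *)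
apply/eqP; rewrite -subr_eq0; apply/eqP/(mulfI (mulf_neq0 f0 (invr_neq0 w0))).
rewrite mulr0 -[RHS]H; field.
by rewrite w0 c0.
Qed.

End Exponents.

(** * Solving the relations between the weights, [a] and [m] *)

(** The hypotheses are the relations for beta = 0, e_j and e_i + e_j. They force a_j = 1 wherever
    w_j is nonzero; an index of weight zero is then paired with one of nonzero weight. *)
Lemma weight_relations_imply (R : realType) (J : Type) (j1 j2 : J)
    (a w : J -> R) (m : R) :
  ~ (forall j, w j = 0) ->
  2 * w j1 = m * w j2 ->
  (forall j, 2 * (w j + 2 * w j1) = (a j + m) * (w j + w j2)) ->
  (forall i j,
     3 * (w i + w j + 2 * w j1) = (a i + a j + m) * (w i + w j + w j2)) ->
  (forall j, a j = 1) /\ (m = 1 \/ m = 2).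
Proof.
move=> w_neq0 H0 H1 H2.
(* The relations for 0, e_j and 2 e_j interpolate a quadratic in k. *)
have Ha j : a j * w j = w j by have := H1 j; have := H2 j j; lra.
(* This is the coefficient of k, where [Ha] was that of k^2. *)
have Hm j : w j + 2 * w j1 = a j * w j2 + m * w j.
  by have := H1 j; have := Ha j; lra.
have a1 j : w j != 0 -> a j = 1.
  by move=> wj; apply: (mulIf wj); rewrite mul1r Ha.
(* If w_2 = 0, then w_1 = 0, and any w_i <> 0 gives m = 1. When w_j = 0, the relation for e_i + e_j
   reads 3 w_i = (a_j + 2) w_i. *)
have [w20|w20] := eqVneq (w j2) 0.
  have w10 : w j1 = 0 by move: H0; rewrite w20; lra.
  have [i /eqP wi] : exists i, w i <> 0 by apply/existsNP.
  have m1 : m = 1 by apply: (mulIf wi); have := Hm i; rewrite w10 w20; lra.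
  split; last by left.
  move=> j; have [wj|/a1 //] := eqVneq (w j) 0.
  have := H2 i j; rewrite (a1 i wi) wj w10 w20 m1 => H.
  by apply: (mulIf wi); lra.
(* The case w_1 = 0, w_2 <> 0 is impossible: m = a_1 = 0 turns the relation for e_1 + e_2 into 3 w_2
   = 2 w_2. *)
have [w10|w10] := eqVneq (w j1) 0.
  have m0 : m = 0 by apply: (mulIf w20); lra.
  have a10 : a j1 = 0 by apply: (mulIf w20); have := Hm j1; rewrite m0 w10; lra.
  have := H2 j1 j2; rewrite a10 (a1 j2 w20) m0 w10 => H.
  by case/eqP: w20; lra.
(* Substituting w_1 = m w_2 / 2 into 3 w_1 = w_2 + m w_1 gives m^2 - 3 m + 2 = 0. *)
have m12 : (m - 1) * (m - 2) = 0.
  apply: (mulIf w20); have := Hm j1; rewrite (a1 _ w10).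
  have -> : w j1 = m * w j2 / 2 by lra.
  lra.
split; last first.
  by move/eqP: m12; rewrite mulf_eq0 !subr_eq0 => /orP[]/eqP; [left|right].
move=> j; have [wj|/a1 //] := eqVneq (w j) 0.
(* A zero weight w_j gives a_j w_2 = 2 w_1 = m w_2. The relation for e_2 + e_j then becomes 3 (1 +
   m) = 2 (1 + 2 m), so m = 1. *)
have aj : a j = m by apply: (mulIf w20); have := Hm j; rewrite wj; lra.
rewrite aj; apply: (mulIf w20).
by have := H2 j2 j; rewrite aj wj (a1 _ w20); lra.
Qed.

Theorem theorem4p3 (R : realType) (a : pindex -> R) (m : R)
    (am_neq0 : ~ ((forall j : pindex, a j = 0) /\ m = 0)) :
  (exists omega : pindex -> int,
     ~ (forall j : pindex, omega j = 0) /\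
     (forall n : nat, (1 <= n)%N -> opD a m (wip R n omega) = 0)) ->
  (forall j : pindex, a j = 1) /\ (m = 1 \/ m = 2).
Proof.
move=> [omega [omega_neq0 HD]].
pose w j : R := (omega j)%:~R.
have H beta : (mdeg beta).+1%:R * (cmdot R w beta + 2 * w i1) =
    (cmdot R a beta + m) * (cmdot R w beta + w i2).
  by apply: opD_wip_eq0; apply: HD; rewrite addn2.
apply: (weight_relations_imply R pindex i1 i2 a w m).
- move=> w0; apply: omega_neq0 => j.
  by have /eqP := w0 j; rewrite intr_eq0 => /eqP.
- by have := H mone; rewrite !cmdot1 mdeg1; lra.
- move=> j; have := H (mmul mone (ucm j)).
  by rewrite !cmdot_mulU !cmdot1 mdeg_mulU mdeg1; lra.
- move=> i j; have := H (mmul (mmul mone (ucm i)) (ucm j)).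
  by rewrite !cmdot_mulU !cmdot1 !mdeg_mulU mdeg1; lra.
Qed.
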